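(* Let $\alpha_0+\alpha_1+2\alpha_2+2\alpha_3=1$ and consider the system $$\frac{dx}{dt}=\frac{-2x^3y+2x^2y-(\alpha_1+2\alpha_2)x^2-(t-1+2\alpha_3)x+t}{t},$$ $$\frac{dy}{dt}=\frac{3x^2y^2-2xy^2+2(\alpha_1+2\alpha_2)xy+(t-1+2\alpha_3)y+(\alpha_1+\alpha_2)\alpha_2}{t}.$$ Make the change of parameters and variables $$\alpha_0=-\frac{1}{2\varepsilon^2},\quad\alpha_1=A_0,\quad\alpha_2=A_1,\quad\alpha_3=\frac{1+6A_2\varepsilon^2}{4\varepsilon^2},$$ $$t=\frac{-1-2\varepsilon T}{2\varepsilon^2},\quad x=\frac{\varepsilon-X}{\varepsilon},\quad y=-\varepsilon Y$$ from $\alpha_0,\dots,\alpha_3,t,x,y$ to $A_0,A_1,A_2,\varepsilon,T,X,Y$. Then the system can be written in the new variables $T,X,Y$ and parameters $A_0,A_1,A_2,\varepsilon$ as a Hamiltonian system, and as $\varepsilon\to0$ this new system tends to the system $$\frac{dX}{dT}=4X^3Y+2(A_0+2A_1)X^2+2TX+1,$$ $$\frac{dY}{dT}=-6X^2Y^2-4(A_0+2A_1)XY-2TY-2A_1(A_0+A_1),$$ with $A_0+2A_1+3A_2=1$.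
   Context: A Hamiltonian system in $(X,Y)$ with independent variable $T$ is one of the form $dX/dT=\partial K/\partial Y$, $dY/dT=-\partial K/\partial X$ for a function $K(X,Y,T)$. ''Tends to'' means that the right-hand sides of the equations, as rational functions of $X,Y,T$ (with $A_i$ fixed), converge as $\varepsilon\to0$ to the right-hand sides of the limit system. *)

(* Defs.v *)
From HB Require Import structures.
From mathcomp Require Import all_boot all_order all_algebra.
From mathcomp Require Import all_classical all_reals all_analysis.

Set Implicit Arguments.
Unset Strict Implicit.
Unset Printing Implicit Defensive.

Import Order.TTheory GRing.Theory Num.Theory.
Import numFieldNormedType.Exports.

Local Open Scope classical_set_scope.
Local Open Scope ring_scope.

(* Everything is stated over an arbitrary [F : numFieldType], hence both over
   the reals and over the complex numbers [R[i]] of a [realType].  A planar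
   non-autonomous system dx/dt = f(x,y,t), dy/dt = g(x,y,t) is given by its
   right-hand sides [f g : F -> F -> F -> F], with arguments in the order
   x, y, t. *)
Section Systems.
Context {F : numFieldType}.

Definition solution_at (f g : F -> F -> F -> F) (x y : F -> F) (t : F) : Prop :=
  is_derive t 1 x (f (x t) (y t) t) /\ is_derive t 1 y (g (x t) (y t) t).

(* The derivatives are partial derivatives at fixed time; only the times
   satisfying [D] matter, so that poles in T can be excluded. *)
Definition hamiltonian_on (D : set F) (f g K : F -> F -> F -> F) : Prop :=
  forall X Y T : F, D T ->
    is_derive Y 1 (fun Y' : F => K X Y' T) (f X Y T) /\
    is_derive X 1 (fun X' : F => K X' Y T) (- g X Y T).

(* Under t = tau T, x = xi X, y = eta Y, the system (f, g) reads (f', g') at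
   the times T satisfying [D].  The equivalence is required pointwise in T,
   which implies the equivalence of being a solution on U and on tau(U), and
   determines f' and g' at all times in [D]. *)
Definition rewrites_to (tau xi eta : F -> F) (D : set F)
    (f g f' g' : F -> F -> F -> F) : Prop :=
  forall (U : set F) (x y X Y : F -> F),
    open U -> U `<=` D ->
    (forall T : F, U T -> x (tau T) = xi (X T) /\ y (tau T) = eta (Y T)) ->
    forall T : F, U T ->
      (solution_at f g x y (tau T) <-> solution_at f' g' X Y T).

(* Convergence as eps -> 0, eps <> 0, of functions of (X, Y, T): uniform on
   bounded sets, in particular pointwise. *)
Definition tends_to (h : F -> F -> F -> F -> F) (h0 : F -> F -> F -> F) : Prop :=
  forall M : F,
    {uniform [set p : F * F * F | `|p| <= M],
      (fun (eps : F) (p : F * F * F) => h eps p.1.1 p.1.2 p.2) @ (0 : F)^' -->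
      (fun p : F * F * F => h0 p.1.1 p.1.2 p.2)}.

Definition rhs_x (a1 a2 a3 x y t : F) : F :=
  (- 2 * x ^+ 3 * y + 2 * x ^+ 2 * y - (a1 + 2 * a2) * x ^+ 2
   - (t - 1 + 2 * a3) * x + t) / t.

Definition rhs_y (a1 a2 a3 x y t : F) : F :=
  (3 * x ^+ 2 * y ^+ 2 - 2 * x * y ^+ 2 + 2 * (a1 + 2 * a2) * x * y
   + (t - 1 + 2 * a3) * y + (a1 + a2) * a2) / t.

Definition alpha0 (eps : F) : F := - (1 / (2 * eps ^+ 2)).
Definition alpha1 (A0 : F) : F := A0.
Definition alpha2 (A1 : F) : F := A1.
Definition alpha3 (A2 eps : F) : F :=
  (1 + 6 * A2 * eps ^+ 2) / (4 * eps ^+ 2).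

Definition t_of (eps T : F) : F := (- 1 - 2 * eps * T) / (2 * eps ^+ 2).
Definition x_of (eps X : F) : F := (eps - X) / eps.
Definition y_of (eps Y : F) : F := - eps * Y.

Definition lim_rhs_X (A0 A1 X Y T : F) : F :=
  4 * X ^+ 3 * Y + 2 * (A0 + 2 * A1) * X ^+ 2 + 2 * T * X + 1.

Definition lim_rhs_Y (A0 A1 X Y T : F) : F :=
  - 6 * X ^+ 2 * Y ^+ 2 - 4 * (A0 + 2 * A1) * X * Y - 2 * T * Y
  - 2 * A1 * (A0 + A1).

End Systems.

(* Main.v *)
Require Import Defs.
From HB Require Import structures.
From mathcomp Require Import all_boot all_order all_algebra.
From mathcomp Require Import all_classical all_reals all_analysis.
From mathcomp Require Import ring.

Set Implicit Arguments.
Unset Strict Implicit.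
Unset Printing Implicit Defensive.

Import Order.TTheory GRing.Theory Num.Theory.
Import numFieldNormedType.Exports.

Local Open Scope classical_set_scope.
Local Open Scope ring_scope.

(* The change of variables is affine in each of t, x, y, with dt/dT = - 1/eps,
   so the chain rule multiplies the right-hand sides by the constants 1 and
   1/eps^2.  Substituting alpha_3 and using A0 + 2 A1 + 3 A2 = 1 to eliminate
   A2, all negative powers of eps cancel, and the new right-hand sides are
   polynomials in X, Y, T, eps divided by 1 + 2 eps T; at fixed time an explicit
   polynomial integrates them to a Hamiltonian, cubic in X and quadratic in Y.
   They differ from their values at eps = 0 by eps times an expression which is
   bounded for bounded X, Y, T and small eps, whence the uniform limit. *)

(** * Chain rule and affine changes of variables *)

Section Derivatives.
Context {F : numFieldType}.

Lemma is_derive_comp_diff (U V W : normedModType F) (g : U -> V) (f : V -> W)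
    (x v : U) (b : V) :
  differentiable g x -> is_derive x v g b -> differentiable f (g x) ->
  is_derive x v (f \o g) ('d f (g x) b).
Proof.
move=> dg [_ <-] df.
have dfg := differentiable_comp dg df.
apply: DeriveDef; first exact: diff_derivable.
by rewrite (deriveE _ dfg) (deriveE _ dg) (diff_comp dg df).
Qed.

(* [is_derive1_comp] of the library is restricted to a [realType]. *)
Lemma is_derive1_comp_num (f g : F -> F) (x a b : F) :
  is_derive (g x) 1 f a -> is_derive x 1 g b -> is_derive x 1 (f \o g) (a * b).
Proof.
move=> [/derivable1_diffP df <-] dgb.
have dg : differentiable g x by apply/derivable1_diffP; case: dgb.
have := is_derive_comp_diff dg dgb df.
have <- : 'd f (g x) b = 'D_1 f (g x) * b.
  rewrite (deriveE _ df) -[X in 'd f _ X]mulr1.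
  by rewrite [LHS]linearZ mulrC.
by [].
Qed.

(** Serves both partial derivatives of the Hamiltonian at fixed time; in the direction of Y the
    leading coefficient is 0. *)
Lemma is_derive_cubic (a b c d x : F) :
  is_derive x 1 (fun z => a * z ^+ 3 + b * z ^+ 2 + c * z + d)
    (3 * a * x ^+ 2 + 2 * b * x + c).
Proof.
have d3 := is_deriveZ a (is_deriveX 3 (is_derive_id x 1)).
have d2 := is_deriveZ b (is_deriveX 2 (is_derive_id x 1)).
have d1 := is_deriveZ c (is_derive_id x 1).
have dp := is_deriveD (is_deriveD (is_deriveD d3 d2) d1) (is_derive_cst d x 1).
by apply: (is_derive_eq dp); rewrite /GRing.scale /=; ring.
Qed.

Lemma is_derive_affine (a b x : F) : is_derive x 1 (fun z => a + b * z) b.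
Proof.
have := is_derive_cubic 0 0 b a x.
rewrite !mulr0 !mul0r !add0r; congr is_derive.
by apply/funext => z; rewrite !mul0r !add0r addrC.
Qed.

(** Each direction is the chain rule: [X] is locally an affine function of [x] after the time
    change, and [x] is locally an affine function of [X] after the inverse time change. *)
Lemma is_derive_affine_change (x X : F -> F) (a b c d T v : F) :
  b != 0 -> d != 0 -> (\near T, x (a + b * T) = c + d * X T) ->
  is_derive (a + b * T) 1 x v <-> is_derive T 1 X (b * v / d).
Proof.
move=> b0 d0 xX; split=> [dx|dX].
- have dxX : is_derive T 1 (fun T' => x (a + b * T')) (v * b).
    exact: (is_derive1_comp_num (g := fun T' => a + b * T')
      dx (is_derive_affine _ _ _)).
  have -> : b * v / d = d^-1 * (v * b) by field.
  have := is_derive1_comp_num (is_derive_affine (- c / d) d^-1 _) dxX.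
  apply: near_eq_is_derive; near=> T' => /=.
  by rewrite (near xX T')//; field.
- have tauK (t : F) : a + b * (- a / b + b^-1 * t) = t by field.
  have sT : - a / b + b^-1 * (a + b * T) = T by field.
  rewrite -[in is_derive T _ _ _]sT in dX.
  have dXs := is_derive1_comp_num (g := fun t => - a / b + b^-1 * t)
      dX (is_derive_affine _ _ _).
  have -> : v = d * (b * v / d * b^-1) by field; apply/andP.
  have := is_derive1_comp_num (is_derive_affine c d _) dXs.
  apply: near_eq_is_derive => /=.
  (* Continuity of the inverse time change carries the neighbourhood of [T] given by [xX] to one of
     [a + b * T]. *)
  have cs : {for a + b * T, continuous (fun t => - a / b + b^-1 * t)}.
    apply: differentiable_continuous; apply/derivable1_diffP.
    by case: (is_derive_affine (- a / b) b^-1 (a + b * T)).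
  rewrite /prop_for /continuous_at sT in cs.
  have csX : \forall t \near a + b * T,
      x (a + b * (- a / b + b^-1 * t)) = c + d * X (- a / b + b^-1 * t).
    exact: cs _ xX.
  by apply: filterS csX => t; rewrite tauK => ->.
Unshelve. all: by end_near. Qed.

End Derivatives.

(** * Bounds uniform in small eps, and uniform convergence *)

Section Bounded.
Context {F : numFieldType}.
Implicit Type R : F -> F -> F -> F -> F.

(** [B] depends on [M] only. The property is stable under ring operations, so it can be read off the
    syntax of a remainder. *)
Definition bounded_near0 R := forall M : F, exists B : F,
  \forall eps \near (0 : F), forall X Y T : F,
    `|X| <= M -> `|Y| <= M -> `|T| <= M -> `|R eps X Y T| <= B.

Lemma bounded_near0_cst c : bounded_near0 (fun _ _ _ _ => c).
Proof.
by move=> M; exists `|c|; near=> eps.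
Unshelve. all: by end_near. Qed.

Lemma bounded_near0_eps : bounded_near0 (fun eps _ _ _ => eps).
Proof.
move=> M; exists 1; near=> eps => X Y T _ _ _.
near: eps; apply: (@nbhs0_le F F); exact: ltr01.
Unshelve. all: by end_near. Qed.

Lemma bounded_near0_X : bounded_near0 (fun _ X _ _ => X).
Proof.
by move=> M; exists M; near=> eps.
Unshelve. all: by end_near. Qed.

Lemma bounded_near0_Y : bounded_near0 (fun _ _ Y _ => Y).
Proof.
by move=> M; exists M; near=> eps.
Unshelve. all: by end_near. Qed.

Lemma bounded_near0_T : bounded_near0 (fun _ _ _ T => T).
Proof.
by move=> M; exists M; near=> eps.
Unshelve. all: by end_near. Qed.

Lemma bounded_near0D R S : bounded_near0 R -> bounded_near0 S ->
  bounded_near0 (fun eps X Y T => R eps X Y T + S eps X Y T).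
Proof.
move=> bR bS M; have [B RB] := bR M; have [C SC] := bS M.
exists (B + C); near=> eps => X Y T XM YM TM.
apply: le_trans (ler_normD _ _) _.
by apply: lerD; [apply: (near RB eps) | apply: (near SC eps)].
Unshelve. all: by end_near. Qed.

Lemma bounded_near0M R S : bounded_near0 R -> bounded_near0 S ->
  bounded_near0 (fun eps X Y T => R eps X Y T * S eps X Y T).
Proof.
move=> bR bS M; have [B RB] := bR M; have [C SC] := bS M.
exists (B * C); near=> eps => X Y T XM YM TM.
rewrite normrM.
by apply: ler_pM => //; [apply: (near RB eps) | apply: (near SC eps)].
Unshelve. all: by end_near. Qed.

Lemma bounded_near0N R : bounded_near0 R ->
  bounded_near0 (fun eps X Y T => - R eps X Y T).
Proof.
move=> bR M; have [B RB] := bR M; exists B; near=> eps => X Y T XM YM TM.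
by rewrite normrN; apply: (near RB eps).
Unshelve. all: by end_near. Qed.

Lemma bounded_near0_exp R n : bounded_near0 R ->
  bounded_near0 (fun eps X Y T => R eps X Y T ^+ n).
Proof.
move=> bR M; have [B RB] := bR M; exists (B ^+ n).
near=> eps => X Y T XM YM TM; have RBe : `|R eps X Y T| <= B.
  by apply: (near RB eps).
by rewrite normrX lerXn2r// nnegrE (le_trans _ RBe).
Unshelve. all: by end_near. Qed.

Lemma near0_denom_lb (M : F) :
  \forall eps \near (0 : F), forall T : F,
    `|T| <= M -> 2^-1 <= `|1 + 2 * eps * T|.
Proof.
near=> eps => T TM.
have M0 : 0 <= M := le_trans (normr_ge0 T) TM.
have small : `|2 * eps * T| <= 2^-1.
  (* The radius for eps must not depend on [T], whose bound is what makes [M] nonnegative; [|M| + 1]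
     is positive for every [M], even a non-real one. *)
  have M1 : 0 < 4 * (`|M| + 1) by rewrite mulr_gt0// ltr_wpDl.
  have eM : `|eps| <= (4 * (`|M| + 1))^-1.
    by near: eps; apply: (@nbhs0_le F F); rewrite invr_gt0.
  apply: (@le_trans _ _ (2 * (4 * (`|M| + 1))^-1 * (`|M| + 1))).
    rewrite !normrM (ger0_norm (ler0n F 2)).
    apply: ler_pM => //; first by rewrite ler_pM2l.
    by rewrite (ger0_norm M0) (le_trans TM)// lerDl.
  have M1' : `|M| + 1 != 0 by rewrite gt_eqF// ltr_wpDl.
  suff -> : 2 * (4 * (`|M| + 1))^-1 * (`|M| + 1) = 2^-1 by [].
  by field.
have -> : 2^-1 = 1 - 2^-1 :> F by field.
apply: le_trans (lerB_normD _ _); rewrite normr1.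
by rewrite lerD2l lerN2.
Unshelve. all: by end_near. Qed.

Lemma bounded_near0_denomV :
  bounded_near0 (fun eps _ _ T => (1 + 2 * eps * T)^-1).
Proof.
move=> M; exists 2.
apply: filterS (near0_denom_lb M) => eps lb X Y T _ _ TM.
have l := lb T TM.
rewrite normfV -[leRHS]invrK lef_pV2// posrE ?invr_gt0//.
by apply: lt_le_trans l; rewrite invr_gt0.
Qed.

(** For [|T| <= M] and small eps the denominator is nonzero, so the error is at most
    [|eps| * (|B| + 1)], uniformly in X, Y, T. *)
Lemma tends_to_eps_mul (h : F -> F -> F -> F -> F) (h0 : F -> F -> F -> F) R :
  bounded_near0 R ->
  (forall eps X Y T, 1 + 2 * eps * T != 0 ->
     h eps X Y T = h0 X Y T + eps * R eps X Y T) ->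
  tends_to h h0.
Proof.
move=> bR hE M P /uniform_nbhs [E [entE EP]]; apply: (filterS EP) => {EP}.
move: entE; rewrite -entourage_ballE => -[e /= e0 eE].
have [B RB] := bR M.
apply: nbhs_dnbhs; near=> eps => -[[X Y] T] /= pM.
have [XM YM TM] : [/\ `|X| <= M, `|Y| <= M & `|T| <= M].
  (* The product carries the maximum norm; the order of [F] may be partial, but norms are real and
     hence comparable. *)
  move: pM; rewrite !prod_normE /= !comparable_ge_max ?real_comparable//.
  by move=> /andP[/andP[-> ->] ->].
apply: eE; rewrite /= -ball_normE /= hE; last first.
  have lb : 2^-1 <= `|1 + 2 * eps * T| by apply: (near (near0_denom_lb M) eps).
  by rewrite -normr_gt0; apply: lt_le_trans lb; rewrite invr_gt0.
rewrite opprD addNKr normrN normrM.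
have RBe : `|R eps X Y T| <= B by apply: (near RB eps).
have B0 : 0 <= B := le_trans (normr_ge0 _) RBe.
have B1 : 0 < `|B| + 1 by rewrite ltr_wpDl.
apply: (@le_lt_trans _ _ (`|eps| * (`|B| + 1))).
  by rewrite ler_wpM2l// (le_trans RBe)// (ger0_norm B0) lerDl.
rewrite -ltr_pdivlMr//; near: eps; apply: (@nbhs0_lt F F).
by rewrite divr_gt0.
Unshelve. all: by end_near. Qed.

End Bounded.

Ltac bounded := repeat first
  [ exact: bounded_near0_denomV | exact: bounded_near0_eps
  | exact: bounded_near0_X | exact: bounded_near0_Y | exact: bounded_near0_T
  | exact: bounded_near0_cst | apply: bounded_near0D | apply: bounded_near0N
  | apply: bounded_near0_exp | apply: bounded_near0M ].

(** * The transformed system, its Hamiltonian and its limit *)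

Section System.
Context {F : numFieldType}.
Implicit Types A eps X Y T : F.

Lemma t_of_numerator eps T : - 1 - 2 * eps * T = - (1 + 2 * eps * T).
Proof. by ring. Qed.

Lemma t_of_neq0 eps T : eps != 0 -> t_of eps T != 0 -> 1 + 2 * eps * T != 0.
Proof.
move=> e0; apply: contra_neq => D0.
by rewrite /t_of t_of_numerator D0 oppr0 mul0r.
Qed.

(** Closed form free of negative powers of eps, so that [eps = 0] gives the limit right-hand side;
    likewise for [sys_Y]. *)
Definition sys_X (A0 A1 : F) eps X Y T : F :=
  (4 * X * Y * (eps - X) ^+ 2 + 2 * (A0 + 2 * A1) * (eps - X) ^+ 2
   + 2 * (T + eps * (A0 + 2 * A1)) * (X - eps) + 1 + 2 * eps * T)
  / (1 + 2 * eps * T).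

Definition sys_Y (A0 A1 : F) eps X Y T : F :=
  - 2 * (Y ^+ 2 * (eps - X) * (eps - 3 * X)
         - 2 * (A0 + 2 * A1) * (eps - X) * Y
         + (T + eps * (A0 + 2 * A1)) * Y + A1 * (A0 + A1))
  / (1 + 2 * eps * T).

(** Integral of [sys_X] in Y at fixed X and T; the Y equation fixes the remaining term, the one free
    of Y. *)
Definition sys_K (A0 A1 : F) eps X Y T : F :=
  (2 * X * Y ^+ 2 * (eps - X) ^+ 2 + 2 * (A0 + 2 * A1) * (eps - X) ^+ 2 * Y
   + 2 * (T + eps * (A0 + 2 * A1)) * (X - eps) * Y + (1 + 2 * eps * T) * Y
   + 2 * A1 * (A0 + A1) * X)
  / (1 + 2 * eps * T).

(** The factor [- eps^-1] is dt/dT and the divisor is dx/dX, as in the form [b * v / d] of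
    [is_derive_affine_change]; for Y the divisor is dy/dY = [- eps]. *)
Lemma sys_XE (A0 A1 A2 : F) eps X Y T :
  A0 + 2 * A1 + 3 * A2 = 1 -> eps != 0 -> 1 + 2 * eps * T != 0 ->
  sys_X A0 A1 eps X Y T =
  - eps^-1 * rhs_x (alpha1 A0) (alpha2 A1) (alpha3 A2 eps)
    (x_of eps X) (y_of eps Y) (t_of eps T) / (- eps^-1).
Proof.
move=> A012 e0 D0.
(* With the next rewrite this substitutes 1 - 2 A1 - 3 A2 for [A0], leaving an identity in free
   parameters. *)
have -> : A0 = (A0 + 2 * A1 + 3 * A2) - 2 * A1 - 3 * A2 by ring.
rewrite A012.
rewrite /sys_X /rhs_x /alpha1 /alpha2 /alpha3 /x_of /y_of /t_of.
by field; rewrite e0 t_of_numerator oppr_eq0 D0.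
Qed.

Lemma sys_YE (A0 A1 A2 : F) eps X Y T :
  A0 + 2 * A1 + 3 * A2 = 1 -> eps != 0 -> 1 + 2 * eps * T != 0 ->
  sys_Y A0 A1 eps X Y T =
  - eps^-1 * rhs_y (alpha1 A0) (alpha2 A1) (alpha3 A2 eps)
    (x_of eps X) (y_of eps Y) (t_of eps T) / (- eps).
Proof.
move=> A012 e0 D0.
have -> : A0 = (A0 + 2 * A1 + 3 * A2) - 2 * A1 - 3 * A2 by ring.
rewrite A012.
rewrite /sys_Y /rhs_y /alpha1 /alpha2 /alpha3 /x_of /y_of /t_of.
by field; rewrite e0 t_of_numerator oppr_eq0 D0.
Qed.

Lemma sys_K_hamiltonian (A0 A1 : F) eps (D : set F) :
  hamiltonian_on D (sys_X A0 A1 eps) (sys_Y A0 A1 eps) (sys_K A0 A1 eps).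
Proof.
(* With the reciprocal [i] as an atom, all identities below are polynomial. *)
move=> X Y T _; set i := (1 + 2 * eps * T)^-1; set a := A0 + 2 * A1; split.
- have -> : sys_X A0 A1 eps X Y T =
      3 * 0 * Y ^+ 2 + 2 * (2 * X * (eps - X) ^+ 2 * i) * Y +
      (2 * a * (eps - X) ^+ 2 + 2 * (T + eps * a) * (X - eps)
       + 1 + 2 * eps * T) * i.
    by rewrite /sys_X -/a -/i; ring.
  have -> : (fun Y' => sys_K A0 A1 eps X Y' T) =
      (fun z => 0 * z ^+ 3 + (2 * X * (eps - X) ^+ 2 * i) * z ^+ 2 +
        (2 * a * (eps - X) ^+ 2 + 2 * (T + eps * a) * (X - eps)
         + 1 + 2 * eps * T) * i * z + 2 * A1 * (A0 + A1) * X * i).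
    by apply/funext => z; rewrite /sys_K -/a -/i; ring.
  exact: is_derive_cubic.
- have -> : - sys_Y A0 A1 eps X Y T =
      3 * (2 * Y ^+ 2 * i) * X ^+ 2
      + 2 * ((- (4 * eps * Y ^+ 2) + 2 * a * Y) * i) * X
      + (2 * eps ^+ 2 * Y ^+ 2 - 4 * a * eps * Y + 2 * (T + eps * a) * Y
         + 2 * A1 * (A0 + A1)) * i.
    by rewrite /sys_Y -/a -/i; ring.
  have -> : (fun X' => sys_K A0 A1 eps X' Y T) =
      (fun z => 2 * Y ^+ 2 * i * z ^+ 3
        + (- (4 * eps * Y ^+ 2) + 2 * a * Y) * i * z ^+ 2
        + (2 * eps ^+ 2 * Y ^+ 2 - 4 * a * eps * Y + 2 * (T + eps * a) * Y
           + 2 * A1 * (A0 + A1)) * i * z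
        + (2 * a * eps ^+ 2 * Y - 2 * (T + eps * a) * eps * Y
           + (1 + 2 * eps * T) * Y) * i).
    by apply/funext => z; rewrite /sys_K -/a -/i; ring.
  exact: is_derive_cubic.
Qed.

Lemma sys_X_lim (A0 A1 : F) : tends_to (sys_X A0 A1) (lim_rhs_X A0 A1).
Proof.
pose a := A0 + 2 * A1.
(* With N(eps) the numerator of [sys_X], the remainder is ((N(eps) - N(0)) / eps - 2 T N(0)) / (1 +
   2 eps T), where N(0) is [lim_rhs_X]. *)
apply: (@tends_to_eps_mul _ _ _ (fun eps X Y T =>
  (4 * X * Y * (eps + - 2 * X) + 2 * a * (eps + - 2 * X)
   + 2 * (a * X + - T + - (eps * a)) + 2 * T
   + - 2 * T * lim_rhs_X A0 A1 X Y T) * (1 + 2 * eps * T)^-1)).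
  rewrite /lim_rhs_X; bounded.
move=> eps X Y T D0; rewrite /sys_X /lim_rhs_X /a.
by field.
Qed.

Lemma sys_Y_lim (A0 A1 : F) : tends_to (sys_Y A0 A1) (lim_rhs_Y A0 A1).
Proof.
pose a := A0 + 2 * A1.
apply: (@tends_to_eps_mul _ _ _ (fun eps X Y T =>
  (- 2 * (Y * Y * (eps + - 4 * X) + - 2 * a * Y + a * Y)
   + - 2 * T * lim_rhs_Y A0 A1 X Y T) * (1 + 2 * eps * T)^-1)).
  rewrite /lim_rhs_Y; bounded.
move=> eps X Y T D0; rewrite /sys_Y /lim_rhs_Y /a.
by field.
Qed.

End System.

Theorem theorem2p3 (F : numFieldType) (A0 A1 A2 : F) :
  (forall eps : F, eps != 0 ->
     (alpha0 eps + alpha1 A0 + 2 * alpha2 A1 + 2 * alpha3 A2 eps = 1 <->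
      A0 + 2 * A1 + 3 * A2 = 1)) /\
  (A0 + 2 * A1 + 3 * A2 = 1 ->
   exists f g : F -> F -> F -> F -> F,
     [/\ forall eps : F, eps != 0 ->
           rewrites_to (t_of eps) (x_of eps) (y_of eps)
             [set T | t_of eps T != 0]
             (rhs_x (alpha1 A0) (alpha2 A1) (alpha3 A2 eps))
             (rhs_y (alpha1 A0) (alpha2 A1) (alpha3 A2 eps))
             (f eps) (g eps),
         forall eps : F, eps != 0 ->
           exists K : F -> F -> F -> F,
             hamiltonian_on [set T | t_of eps T != 0] (f eps) (g eps) K,
         tends_to f (lim_rhs_X A0 A1) &
         tends_to g (lim_rhs_Y A0 A1)]).
Proof.
split=> [eps e0|A012].
  (* The poles of [alpha0] and [2 * alpha3] cancel, and what is left of the latter is [3 * A2]. *)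
  suff -> : alpha0 eps + alpha1 A0 + 2 * alpha2 A1 + 2 * alpha3 A2 eps =
            A0 + 2 * A1 + 3 * A2 by [].
  by rewrite /alpha0 /alpha1 /alpha2 /alpha3; field.
exists (sys_X A0 A1), (sys_Y A0 A1); split.
- move=> eps e0 U x y X Y oU UD xyXY T UT.
  have [xT yT] := xyXY T UT.
  have D0 : 1 + 2 * eps * T != 0 by apply: (t_of_neq0 e0); exact: UD.
  (* Openness of [U] turns the relations on [U] into the local ones that derivatives at [T]
     require. *)
  have nU : \forall T' \near T, U T' by exact: open_nbhs_nbhs.
  have tE T' : t_of eps T' = - (2 * eps ^+ 2)^-1 + - eps^-1 * T'.
    by rewrite /t_of; field.
  have b0 : - eps^-1 != 0 by rewrite oppr_eq0 invr_eq0.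
  have Ne0 : - eps != 0 by rewrite oppr_eq0.
  have xX : \near T, x (- (2 * eps ^+ 2)^-1 + - eps^-1 * T) =
                     1 + - eps^-1 * X T.
    apply: filterS nU => T' UT'; rewrite -tE (xyXY T' UT').1 /x_of; field.
    exact: e0.
  have yY : \near T, y (- (2 * eps ^+ 2)^-1 + - eps^-1 * T) = 0 + - eps * Y T.
    by apply: filterS nU => T' UT'; rewrite -tE (xyXY T' UT').2 add0r.
  rewrite /solution_at xT yT.
  have -> : sys_X A0 A1 eps (X T) (Y T) T =
      - eps^-1 * rhs_x (alpha1 A0) (alpha2 A1) (alpha3 A2 eps)
        (x_of eps (X T)) (y_of eps (Y T)) (t_of eps T) / (- eps^-1).
    exact: sys_XE.
  have -> : sys_Y A0 A1 eps (X T) (Y T) T =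
      - eps^-1 * rhs_y (alpha1 A0) (alpha2 A1) (alpha3 A2 eps)
        (x_of eps (X T)) (y_of eps (Y T)) (t_of eps T) / (- eps).
    exact: sys_YE.
  rewrite [X in is_derive X]tE.
  have iffx := is_derive_affine_change _ b0 b0 xX.
  have iffy := is_derive_affine_change _ b0 Ne0 yY.
  by split=> -[dx dy]; split; [apply/iffx|apply/iffy|apply/iffx|apply/iffy].
- by move=> eps e0; exists (sys_K A0 A1 eps); exact: sys_K_hamiltonian.
- exact: sys_X_lim.
- exact: sys_Y_lim.
Qed.
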